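(* Let $c=(c_t)_{0\le t\le T}$ be a cash flow (a nonnegative progressively measurable process). For each $k=1,\dots,K$, the fundamental value $F_t(c)$ of $c$ under $\mathbb P$ and the fundamental value $F^k_t(c)$ of $c$ under $\mathbb P_k$ are related by $$F_t(c)=F^k_t(c)+\frac{1}{\xi_t}\,\mathbb E_t\left[\int_{\tau_k}^T \xi_s c_s\,ds\right],\qquad 0\le t<\tau_k,\quad \mathbb P\text{-a.s.}$$
   Context: Fix $T>0$. $(\Omega,\mathcal F,\mathbb P)$ is a probability space carrying an $n$-dimensional Brownian motion $X=(X_1,\dots,X_n)$, and $(\mathcal F_t)_{0\le t\le T}$ is the (augmented) filtration generated by $X$. $\mathbb E$ is expectation under $\mathbb P$ and $\mathbb E_t[\,\cdot\,]=\mathbb E[\,\cdot\mid\mathcal F_t]$. Conventions: $\int_a^b f(s)\,ds=\int_{[a,b)}f(s)\,ds$, equal to $0$ if $b\le a$; $\inf\emptyset=\infty$. Beliefs. There are agents $k=1,\dots,K$; agent $k$ has beliefs given by a probability measure $\mathbb P_k\ll\mathbb P$ (neither $\mathbb P\ll\mathbb P_k$ nor any relation between the $\mathbb P_k$ is assumed). $\mathbb E^k$, $\mathbb E^k_t$ denote expectation and $\mathcal F_t$-conditional expectation under $\mathbb P_k$. The density process is $Z_{kt}=\mathbb E_t[d\mathbb P_k/d\mathbb P]$ (continuous version), and $\tau_k=\inf\{t\in[0,T]:Z_{kt}=0\}$. Standing assumption: $\mathbb P(\max_k\tau_k=\infty)=1$. The measures $\mathbb P_k$ and $\mathbb P$ are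 equivalent when restricted to $\mathcal F_t\cap\{t<\tau_k\}$, and $\mathbb P_k(\tau_k\le T)=0$; so $\mathbb P_k$-conditional expectations given $\mathcal F_t$ are $\mathbb P$-a.s. well defined on $\{t<\tau_k\}$. State price density. The financial market has interest rate process $r$ with $\int_0^T|r_t|dt<\infty$ and a market price of risk process $\theta$ ($\mathbb R^n$-valued) with $\int_0^T\|\theta_t\|^2dt<\infty$, $\mathbb P$-a.s., and state price density $$\xi_t=\xi_0\exp\Big(-\int_0^t r_s ds-\int_0^t\theta_s^\top dX_s-\tfrac12\int_0^t\|\theta_s\|^2ds\Big),\qquad \xi_0>0.$$ Agent $k$'s state price density is $\xi_{kt}=\xi_t/Z_{kt}$ for $0\le t<\tau_k$ (hence for all $t\in[0,T]$, $\mathbb P_k$-a.s.). Fundamental values. The fundamental value of $c$ at time $t$ under $\mathbb P_k$ is the minimal time-$t$ wealth needed to finance $c$ over $[t,T]$, $\mathbb P_k$-a.s., by a self-financing strategy with nonnegative wealth; in the complete market considered it is given by $$F^k_t(c)=\frac1{\xi_{kt}}\mathbb E^k_t\Big[\int_t^T\xi_{ks}c_s\,ds\Big],\qquad 0\le t<\tau_k,\ \mathbb P\text{-a.s.}$$ (left undefined after $\tau_k$), and the fundamental value under the reference measure $\mathbb P$ is $F_t(c)=\frac1{\xi_t}\mathbb E_t[\int_t^T\xi_sc_s\,ds]$. *)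

(* Defs.v *)
From HB Require Import structures.
From mathcomp Require Import all_boot all_order all_algebra.
From mathcomp Require Import all_classical all_reals all_analysis.
From mathcomp Require Import measurable_realfun.

Set Implicit Arguments.
Unset Strict Implicit.
Unset Printing Implicit Defensive.

Import Order.TTheory GRing.Theory Num.Theory.
Import numFieldNormedType.Exports.

Local Open Scope classical_set_scope.
Local Open Scope ring_scope.
Local Open Scope ereal_scope.
Local Open Scope charge_scope.

(* A process is a function of the time s : R and of w; only the times in
   [0, T] matter. A sigma-algebra is given by a set G of generators and stands
   for <<s G>>; a filtration F is a family of such sets, and measurability
   with respect to F t is measurability on the type g_sigma_algebraType (F t),
   which is Omega equipped with the sigma-algebra <<s F t>>. *)
Section stochastic_processes.
Context {R : realType} {d : measure_display} {Omega : measurableType d}.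
Implicit Types (P : probability Omega R) (F : R -> set (set Omega)) (T : R).

Definition adapted F T (Y : R -> Omega -> R) : Prop :=
  forall t, (0 <= t <= T)%R ->
    measurable_fun [set: g_sigma_algebraType (F t)] (Y t).

Definition progressively_measurable F T (Y : R -> Omega -> R) : Prop :=
  forall t, (0 <= t <= T)%R ->
    measurable_fun
      (`[0%R, t] `*` [set: g_sigma_algebraType (F t)])
      (fun p : measurableTypeR R * g_sigma_algebraType (F t) => Y p.1 p.2).

Definition continuous_paths T (Y : R -> Omega -> R) : Prop :=
  forall w, {within `[0%R, T], continuous (fun t => Y t w)}.

(* W is a version of E[Y | <<s G>>]. Used for Y that is P-integrable or P-a.s.
   nonnegative (possibly not integrable, in which case W may take the
   value +oo). *)
Definition cond_expectation P (G : set (set Omega)) (Y W : Omega -> \bar R) :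
    Prop :=
  measurable_fun [set: g_sigma_algebraType G]
    W /\
  forall A, <<s G >> A -> \int[P]_(w in A) W w = \int[P]_(w in A) Y w.

Definition past n (X : 'I_n -> R -> Omega -> R) (t : R) : set (set Omega) :=
  [set A | exists i s (B : set R),
     [/\ (0 <= s <= t)%R, measurable B & A = X i s @^-1` B]].

Definition augmented_past P n (X : 'I_n -> R -> Omega -> R) (t : R) :
    set (set Omega) :=
  past X t `|` [set N | measurable N /\ P N = 0].

(* The last clause says at once that the increment of X over [s, t] is
   independent of the past up to time s and that it has n independent
   coordinates of law N(0, t - s); the second parameter of normal_prob is the
   standard deviation. *)
Definition brownian_motion P T n (X : 'I_n -> R -> Omega -> R) : Prop :=
  [/\ forall i t, (0 <= t <= T)%R -> measurable_fun setT (X i t),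
      {ae P, forall w, forall i, X i 0%R w = 0%R},
      {ae P, forall w, forall i,
         {within `[0%R, T], continuous (fun t => X i t w)}} &
      forall (s t : R) (A : set Omega) (B : 'I_n -> set R),
        (0 <= s)%R -> (s < t)%R -> (t <= T)%R ->
        <<s past X s >> A -> (forall i, measurable (B i)) ->
        P (A `&` [set w | forall i, B i (X i t w - X i s w)%R]) =
        P A * \prod_(i < n) normal_prob 0%R (Num.sqrt (t - s)) (B i)].

(* The integrand sum_j coef j 1_]knot j, knot j.+1]. *)
Record simple_process F T n := SimpleProcess {
  steps : nat;
  knot : nat -> R;
  coef : nat -> 'I_n -> Omega -> R;
  knot_itv : forall j, (0 <= knot j <= T)%R;
  knot_le : forall j, (knot j <= knot j.+1)%R;
  coef_measurable : forall j i,
    measurable_fun [set: g_sigma_algebraType (F (knot j))] (coef j i);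
  coef_bounded : exists C : R, forall j i w, (`|coef j i w| <= C)%R }.

Definition simple_value F T n (H : simple_process F T n)
    (i : 'I_n) (s : R) (w : Omega) : R :=
  (\sum_(j < steps H)
     coef H j i w * \1_(`]knot H j, knot H j.+1]%classic) s)%R.

Definition simple_integral F T n (H : simple_process F T n)
    (X : 'I_n -> R -> Omega -> R) (t : R) (w : Omega) : R :=
  (\sum_(j < steps H) \sum_(i < n) coef H j i w *
     (X i (Num.min t (knot H j.+1)) w - X i (Num.min t (knot H j)) w))%R.

Definition cvg_to_zero_in_probability P (Y : nat -> Omega -> \bar R) : Prop :=
  forall e : R, (0 < e)%R ->
    P [set w | e%:E <= `|Y m w|] @[m --> \oo] --> (0 : \bar R).

(* M is (up to indistinguishability) the Ito integral of theta with respect to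
   the Brownian motion X, theta being progressively measurable with
   int_0^T |theta|^2 ds < oo a.s.: the continuous adapted limit in probability
   of the integrals of simple processes that approximate theta in L^2(ds), in
   probability. *)
Definition ito_integral P F T n (X theta : 'I_n -> R -> Omega -> R)
    (M : R -> Omega -> R) : Prop :=
  [/\ adapted F T M, continuous_paths T M &
      exists H : nat -> simple_process F T n,
        cvg_to_zero_in_probability P (fun m w =>
          \int[lebesgue_measure]_(s in `[0%R, T[)
            (\sum_(i < n) (simple_value (H m) i s w - theta i s w) ^+ 2)%:E) /\
        forall t, (0 <= t <= T)%R ->
          cvg_to_zero_in_probability P (fun m w =>
            (simple_integral (H m) X t w - M t w)%:E)].

End stochastic_processes.

Section fundamental_values.
Context {R : realType} {d : measure_display} {Omega : measurableType d}.
Implicit Types (P Q : probability Omega R) (F : R -> set (set Omega)) (T : R).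

(* Z is a continuous version of the density process of Q. Continuity is
   required of every path: F t contains the null sets. *)
Definition density_process P F T Q (Z : R -> Omega -> R) : Prop :=
  continuous_paths T Z /\
  forall t, (0 <= t <= T)%R ->
    cond_expectation P (F t) ('d (charge_of_finite_measure Q) '/d P)
      (fun w => (Z t w)%:E).

Definition first_zero T (Z : R -> Omega -> R) (w : Omega) : \bar R :=
  ereal_inf [set t%:E | t in [set t : R | (0 <= t <= T)%R /\ Z t w = 0%R]].

(* M stands for the stochastic integral of theta. *)
Definition state_price_density (xi0 : R) (r : R -> Omega -> R) n
    (theta : 'I_n -> R -> Omega -> R) (M : R -> Omega -> R)
    (t : R) (w : Omega) : R :=
  (xi0 * expR (- (\int[lebesgue_measure]_(s in `[0, t[) r s w) - M t w
     - 2^-1 * (\int[lebesgue_measure]_(s in `[0, t[)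
                 \sum_(i < n) theta i s w ^+ 2)))%R.

(* Meaningful before the first zero of Z only, that is, at all times
   almost surely under the measure of density process Z. *)
Definition agent_state_price_density (xi Z : R -> Omega -> R)
    (t : R) (w : Omega) : R := (xi t w / Z t w)%R.

(* V is a version of (1 / xi_t) E^Q[int_t^T xi_s c_s ds | F_t]. *)
Definition fundamental_value Q F T (xi c : R -> Omega -> R) (t : R)
    (V : Omega -> \bar R) : Prop :=
  exists2 W : Omega -> \bar R,
    cond_expectation Q (F t)
      (fun w => \int[lebesgue_measure]_(s in `[t, T[) (xi s w * c s w)%:E) W &
    V = (fun w => ((xi t w)^-1)%:E * W w).

End fundamental_values.

(* Main.v *)
Require Import Defs.
From HB Require Import structures.
From mathcomp Require Import all_boot all_order all_algebra.
From mathcomp Require Import all_classical all_reals all_analysis.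
From mathcomp Require Import measurable_realfun.
From mathcomp Require Import lra.

Set Implicit Arguments.
Unset Strict Implicit.
Unset Printing Implicit Defensive.

Import Order.TTheory GRing.Theory Num.Theory.
Import numFieldNormedType.Exports.

Local Open Scope classical_set_scope.
Local Open Scope ring_scope.
Local Open Scope ereal_scope.

(* Write Q = Pk. For A in F_t, Tonelli and the change of measure at each time
   s >= t turn E^Q[1_A int_t^T xi_s c_s / Z_s ds] into
   E[1_A int_t^T xi_s c_s 1(Z_s > 0) ds]. Since Z stays at 0 after its first
   zero tau, this is E[1_A int_t^tau xi_s c_s ds], which leaves the part over
   [tau, T) as the difference with E[1_A int_t^T xi_s c_s ds]. On {t < tau},
   where Z_t > 0, the conditional expectations are then identified by testing
   against all such A. *)

(** Absorption at 0 is obtained without optional stopping. A maximal inequality bounds by e the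
    [Q]-probability that [Z] falls below e, so [Z] has no zero [Q]-a.s.; the event of a zero up to
    time t is then a [Q]-null set of [F t], and its density [Z t] must vanish [P]-a.e. on it. Two
    obstacles shape the rest. Nothing is assumed integrable, so conditional expectations may be +oo,
    and their uniqueness is proved on sets where one side is bounded rather than by subtraction.
    Moreover signs hold only almost everywhere: [Z] and the versions of conditional expectations may
    be negative on null sets, and for the version under [Q] this set is null only under [Q], while
    [P] is not assumed to be dominated by [Q]. Hence the positive parts and absolute values below,
    which make integrands nonnegative everywhere. A density at time s serves only integrands
    measurable for [F s], so the time integral must be moved outside before the measure is
    changed. *)

Section measure_complements.
Context d {S : measurableType d} {R : realType}.

(** On [D] with f <= n, the function f is integrable because [mu D] is finite, so the integrable
    criterion gives f = g there; the same holds with f and g exchanged. A point outside all these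
    sets has f = g = +oo. *)
Lemma ge0_integral_ae_eq (mu : {measure set S -> \bar R}) (D : set S)
    (f g : S -> \bar R) : measurable D -> mu D < +oo ->
  measurable_fun setT f -> measurable_fun setT g ->
  (forall x, 0 <= f x) -> (forall x, 0 <= g x) ->
  (forall A, A `<=` D -> measurable A ->
     \int[mu]_(x in A) f x = \int[mu]_(x in A) g x) ->
  ae_eq mu D f g.
Proof.
move=> mD muD mf mg f0 g0 fg.
pose B n (h : S -> \bar R) := D `&` [set x | h x <= n%:R%:E].
have mB n h : measurable_fun setT h -> measurable (B n h).
  move=> mh; apply: measurable_lee => //; exact: measurable_funTS.
have key n (h k : S -> \bar R) : measurable_fun setT h -> measurable_fun setT k ->
    (forall x, 0 <= h x) ->
    (forall A, A `<=` D -> measurable A ->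
      \int[mu]_(x in A) h x = \int[mu]_(x in A) k x) ->
    ae_eq mu (B n h) h k.
  move=> mh mk h0 hk; apply: integral_ae_eq; first exact: mB.
  - apply/integrableP; split; first exact: measurable_funTS.
    apply: (@le_lt_trans _ _ (\int[mu]_(x in B n h) (cst n%:R%:E x))).
      apply: ge0_le_integral => //; first exact: mB.
      + apply: measurableT_comp => //; exact: measurable_funTS.
      + by move=> x [_ hx]; rewrite gee0_abs.
    rewrite integral_cst; last exact: mB.
    rewrite lte_mul_pinfty// (le_lt_trans _ muD)// le_measure// ?inE//.
      exact: mB.
    by apply: subIsetl.
  - exact: measurable_funTS.
  - by move=> A AB mA; apply: hk => // x /AB[].
have H1 := ae_foralln (fun n => key n f g mf mg f0 fg).
have H2 := ae_foralln (fun n => key n g f mg mf g0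
  (fun A AD mA => esym (fg A AD mA))).
have bnd (y : \bar R) : 0 <= y -> y != +oo -> exists n, y <= n%:R%:E.
  case: y => [y||]// y0 _; exists (Num.truncn y).+1.
  by rewrite lee_fin ltW// truncnS_gt.
move: H1 H2; apply: filterS2 => x fgx gfx Dx.
have [fx|fx] := eqVneq (f x) +oo; last first.
  have [n fn] := bnd _ (f0 x) fx; exact: (fgx n).
have [gx|gx] := eqVneq (g x) +oo; first by rewrite fx gx.
have [n gn] := bnd _ (g0 x) gx; exact/esym/(gfx n).
Qed.

End measure_complements.

(** * Uniqueness and sign tests relative to a sub-sigma-algebra *)

Section sub_sigma_algebra.
Context d {Omega : measurableType d} {R : realType}.
Implicit Types (P Q : probability Omega R) (G : set (set Omega)).

Lemma measurable_fun_sub G d' (S : measurableType d') (f : Omega -> S) :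
  <<s G >> `<=` measurable ->
  measurable_fun [set: g_sigma_algebraType G] f -> measurable_fun setT f.
Proof.
move=> GM mf _ B mB; apply: GM.
exact: (mf measurableT B mB).
Qed.

Section pushforward_id.
Variables (G : set (set Omega)).
Hypothesis GM : <<s G >> `<=` measurable.

Lemma measurable_id_sub :
  measurable_fun [set: Omega] (id : Omega -> g_sigma_algebraType G).
Proof. by move=> _ B mB; rewrite setTI; exact: GM. Qed.

Definition mid_sub : {mfun Omega >-> g_sigma_algebraType G} :=
  HB.pack (id : Omega -> g_sigma_algebraType G)
    (isMeasurableFun.Build _ _ _ _ _ measurable_id_sub).

(** The restriction of [P] to the sub-sigma-algebra, written as the image under the identity so that
    general theorems apply with [<<s G >>] as the ambient sigma-algebra. *)
Definition restrict P : probability (g_sigma_algebraType G) R :=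
  distribution P mid_sub.

Lemma ge0_integral_restrict P A (f : Omega -> \bar R) : <<s G >> A ->
  measurable_fun [set: g_sigma_algebraType G] f -> (forall x, 0 <= f x) ->
  \int[restrict P]_(x in A) f x = \int[P]_(x in A) f x.
Proof.
move=> GA mf f0.
rewrite (@ge0_integral_pushforward _ _ _ (g_sigma_algebraType G) R
  (id : Omega -> g_sigma_algebraType G) measurable_id_sub)//.
exact: measurable_funTS.
Qed.

Lemma ae_restrict P (H : Omega -> Prop) :
  {ae restrict P, forall w, H w} -> {ae P, forall w, H w}.
Proof. by move=> [N [mN PN sN]]; exists N; split => //; exact: GM. Qed.

(** Uniqueness of conditional expectations, localized to [D]. Test sets from [<<s G >>] are enough
    because, both functions being measurable for it, they are all the measurable sets of
    [restrict P]. *)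
Lemma ge0_sub_ae_eq P D (f g : Omega -> \bar R) : <<s G >> D ->
  measurable_fun [set: g_sigma_algebraType G] f ->
  measurable_fun [set: g_sigma_algebraType G] g ->
  (forall x, 0 <= f x) -> (forall x, 0 <= g x) ->
  (forall A, A `<=` D -> <<s G >> A ->
     \int[P]_(x in A) f x = \int[P]_(x in A) g x) ->
  {ae P, forall w, D w -> f w = g w}.
Proof.
move=> GD mf mg f0 g0 fg; apply: ae_restrict.
apply: ge0_integral_ae_eq => //.
- by rewrite (le_lt_trans (probability_le1 _ _))// ltry.
- by move=> A AD GA; rewrite !ge0_integral_restrict//; exact: fg.
Qed.

(** The set where f < 0 is itself an admissible test set: the integral of f over it is both <= 0 and
    >= 0. *)
Lemma sub_ae_ge0 P (f : Omega -> \bar R) :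
  measurable_fun [set: g_sigma_algebraType G] f ->
  (forall A, <<s G >> A -> 0 <= \int[P]_(x in A) f x) ->
  {ae P, forall w, 0 <= f w}.
Proof.
move=> mf If.
pose A := [set w | f w < 0].
have GA : <<s G >> A.
  rewrite -[A]setTI.
  exact: (@measurable_lte _ (g_sigma_algebraType G) R setT measurableT f
    (cst 0)).
have mA := GM GA.
have mf' := measurable_fun_sub GM mf.
have f0 : \int[P]_(x in A) `|f x| = 0.
  apply/eqP; rewrite eq_le integral_ge0// andbT -oppe_ge0.
  rewrite -integral_ge0N//.
  have := If _ GA; congr (_ <= _); apply: eq_integral => x.
  by rewrite inE => fx; rewrite lte0_abs// oppeK.
move/ae_eq_integral_abs : f0 => /(_ mA (measurable_funTS mf')).
apply: filterS => x; rewrite /= => fx0; rewrite leNgt; apply/negP => fxl.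
by move: (fxl); rewrite fx0 ?ltxx.
Qed.

End pushforward_id.

End sub_sigma_algebra.

(** * Change of measure by a density known on a sub-sigma-algebra *)

Section density_on_sub_sigma_algebra.
Context d {Omega : measurableType d} {R : realType}.
Variables (P Q : probability Omega R) (G : set (set Omega)).
Variable (z : Omega -> R).
Hypothesis GM : <<s G >> `<=` measurable.
Hypothesis QP : Q `<< P.
Hypothesis mz : measurable_fun [set: g_sigma_algebraType G] z.
Hypothesis zQ : forall A, <<s G >> A -> \int[P]_(w in A) (z w)%:E = Q A.

Let mZ : measurable_fun [set: g_sigma_algebraType G] (EFin \o z).
Proof. exact: measurableT_comp. Qed.

Lemma density_ae_ge0 : {ae P, forall w, (0 <= z w)%R}.
Proof.
have := sub_ae_ge0 GM (P := P) (f := EFin \o z) mZ.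
by move=> H; apply: H => A GA; rewrite zQ.
Qed.

(** A version of the density that is nonnegative everywhere, where [z] is so only [P]-a.e. *)
Let zp w := (Num.max (z w) 0)%:E.

Let mzp : measurable_fun [set: g_sigma_algebraType G] zp.
Proof. apply/measurable_EFinP; exact: measurable_maxr. Qed.

Let zp_ge0 w : 0 <= zp w.
Proof. by rewrite lee_fin le_max lexx orbT. Qed.

Lemma integral_density_max0 A :
  <<s G >> A -> \int[P]_(w in A) (Num.max (z w) 0)%:E = Q A.
Proof.
move=> GA; rewrite -zQ//; apply: ae_eq_integral; first exact: GM.
- exact/measurable_funTS/(measurable_fun_sub GM).
- exact/measurable_funTS/(measurable_fun_sub GM).
- move: density_ae_ge0; apply: filterS => w z0 _.
  by rewrite /= max_l.
Qed.

Lemma null_density_max0 A : <<s G >> A -> Q A = 0 ->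
  {ae P, forall w, A w -> Num.max (z w) 0%R = 0%R}.
Proof.
move=> GA QA; have mA := GM GA.
have mzp' := measurable_fun_sub GM mzp.
have : \int[P]_(w in A) `|zp w| = 0.
  rewrite -QA -integral_density_max0//; apply: eq_integral => w _.
  by rewrite gee0_abs.
move/ae_eq_integral_abs => /(_ mA (measurable_funTS mzp')).
by apply: filterS => w /= /[apply] -[].
Qed.

(** Once both measures are restricted to [<<s G >>], the positive part of [z] is a version of the
    Radon-Nikodym derivative, by uniqueness. On the full sigma-algebra it need not be one, hence the
    measurability required of [h]. *)
Lemma ge0_change_of_measure A (h : Omega -> \bar R) : <<s G >> A ->
  measurable_fun [set: g_sigma_algebraType G] h -> (forall w, 0 <= h w) ->
  \int[Q]_(w in A) h w = \int[P]_(w in A) (h w * (Num.max (z w) 0)%:E).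
Proof.
move=> GA mh h0.
have QPG : restrict GM Q `<< restrict GM P.
    apply/null_content_dominatesP => A' mA' PA'.
    by have /null_content_dominatesP := QP; apply => //; exact: GM.
pose f := Radon_Nikodym_SigmaFinite.f (restrict GM Q) (restrict GM P).
have f0 w : 0 <= f w by exact: Radon_Nikodym_SigmaFinite.f_ge0.
have mf : measurable_fun setT f.
  exact: measurable_int (Radon_Nikodym_SigmaFinite.f_integrable QPG).
have fz : ae_eq (restrict GM P) setT f zp.
  apply: ge0_integral_ae_eq => //.
  - by rewrite (le_lt_trans (probability_le1 _ _))// ltry.
  - move=> B _ mB; rewrite -Radon_Nikodym_SigmaFinite.f_integral//.
    by rewrite ge0_integral_restrict// integral_density_max0.
rewrite -[LHS](ge0_integral_restrict GM)//.
rewrite -(Radon_Nikodym_SigmaFinite.change_of_variables QPG)//; last first.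
  exact: measurable_funTS.
rewrite -[RHS](ge0_integral_restrict GM)//; last 2 first.
- exact: (@emeasurable_funM _ (g_sigma_algebraType G)).
- by move=> w; apply: mule_ge0 => //; exact: zp_ge0.
apply: ge0_ae_eq_integral => //.
- apply: measurable_funTS.
  exact: (@emeasurable_funM _ (g_sigma_algebraType G)).
- apply: measurable_funTS.
  exact: (@emeasurable_funM _ (g_sigma_algebraType G)).
- by move=> w _; apply: mule_ge0 => //; exact: zp_ge0.
- by move=> w _; apply: mule_ge0 => //; exact: zp_ge0.
- by move: fz; apply: filterS => w fz _; congr (_ * _); exact: fz.
Qed.

End density_on_sub_sigma_algebra.

(** * The maximal inequality on finite sets of times *)

Section density_process.
Context d {Omega : measurableType d} {R : realType}.
Variables (P Q : probability Omega R) (F : R -> set (set Omega)) (T : R).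
Variable (Z : R -> Omega -> R).
Hypothesis FM : forall t, (0 <= t <= T)%R -> <<s F t >> `<=` measurable.
Hypothesis Fnd : forall s t, (0 <= s)%R -> (s <= t)%R -> (t <= T)%R ->
  <<s F s >> `<=` <<s F t >>.
Hypothesis mZ : forall t, (0 <= t <= T)%R ->
  measurable_fun [set: g_sigma_algebraType (F t)] (Z t).
Hypothesis ZQ : forall t, (0 <= t <= T)%R -> forall A, <<s F t >> A ->
  \int[P]_(w in A) (Z t w)%:E = Q A.

Lemma measurable_finite_hit (s : seq R) (e t : R) : (0 <= t <= T)%R ->
  (forall q, q \in s -> 0 <= q <= t)%R ->
  <<s F t >> [set w | exists2 q, q \in s & (Z q w < e)%R].
Proof.
move=> /andP[t0 tT] st.
rewrite [X in <<s _ >> X](_ : _ =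
    \bigcup_(q in [set` s]) (Z q @^-1` [set x | (x < e)%R])); last first.
  by apply/seteqP; split => w /= [q]; exists q.
apply: (@fin_bigcup_measurable _ (g_sigma_algebraType (F t))) => //.
move=> q /= /st /andP[q0 qt]; apply: (Fnd q0 qt tT).
have := @mZ q _ measurableT [set x | (x < e)%R].
rewrite setTI; apply; first by rewrite q0 (le_trans qt).
by rewrite -[X in measurable X]setTI; exact: measurable_fun_ltr.
Qed.

(* Doob's maximal argument under Q: on the part of the space that first falls
   below e at time q, Q has density Z q < e with respect to P. *)
Lemma finite_hit_le (s : seq R) (e : R) : (0 < e)%R -> pairwise <=%R s ->
  (forall q, q \in s -> 0 <= q <= T)%R ->
  let A := [set w | exists2 q, q \in s & (Z q w < e)%R] in
  Q A <= e%:E * P A.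
Proof.
(* The latest time is the one removed: a fall at an earlier time is an event of [F x], so the event
   [C] minus [B] of a first fall at [x] is in [F x] too, where [Z x] is the density. *)
move=> e0; elim/last_ind: s => [|s x IH] srt s01 /=.
  rewrite [X in Q X](_ : _ = set0); last first.
    by apply/seteqP; split => // w [].
  rewrite [X in P X](_ : _ = set0); last first.
    by apply/seteqP; split => // w [].
  by rewrite !measure0 mule0.
have xT : (0 <= x <= T)%R by apply: s01; rewrite mem_rcons mem_head.
have s01' q : q \in s -> (0 <= q <= T)%R.
  by move=> qs; apply: s01; rewrite mem_rcons inE qs orbT.
move: srt; rewrite pairwise_rcons => /andP[/allP /= sx srt].
pose B := [set w | exists2 q, q \in s & (Z q w < e)%R].
pose C := Z x @^-1` [set y | (y < e)%R].
have FB : <<s F x >> B.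
  apply: measurable_finite_hit => // q qs.
  by have /andP[-> _] := s01' _ qs; exact: sx.
have FC : <<s F x >> C.
  have := @mZ x xT measurableT [set y | (y < e)%R].
  rewrite setTI; apply.
  by rewrite -[X in measurable X]setTI; exact: measurable_fun_ltr.
have FCB : <<s F x >> (C `\` B).
  exact: (@measurableD _ (g_sigma_algebraType (F x))).
have mB := FM xT FB; have mCB := FM xT FCB.
rewrite (_ : [set w | _] = B `|` (C `\` B)); last first.
  apply/seteqP; split => w /=.
    have [Bw _|nBw] := pselect (B w); first by left.
    move=> [q]; rewrite mem_rcons inE => /orP[/eqP->|qs] qe.
      by right; split.
    by left; exists q.
  move=> [[q qs qe]|[xe _]].
    by exists q => //; rewrite mem_rcons inE qs orbT.
  by exists x => //; rewrite mem_rcons inE eqxx.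
have disj : B `&` (C `\` B) = set0 by rewrite setDE setICA setICr setI0.
rewrite !measureU// muleDr//; last by rewrite fin_num_adde_defl// fin_num_measure.
apply: leeD; first exact: IH.
have mm := @mZ x xT.
rewrite -integral_cst//.
apply: (@le_trans _ _ (\int[P]_(w in C `\` B) (Num.max (Z x w) 0)%:E)).
  by rewrite (integral_density_max0 (FM xT) mm (ZQ xT) FCB).
apply: ge0_le_integral => //.
- by move=> w _; rewrite lee_fin le_max lexx orbT.
- apply: measurable_funTS; apply: measurable_fun_sub (FM xT) _.
  by apply/measurable_EFinP; exact: measurable_maxr.
- move=> w [wC _]; rewrite lee_fin ge_max; move: wC; rewrite /C /= => /ltW ->.
  exact: ltW.
Qed.

End density_process.

(** * Reduction of continuous paths to countably many times *)

Section paths.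
Context {R : realType}.
Implicit Types (f : R -> R) (p u e : R).

(** Clipped rationals form a dense family of times of [0, p] indexed by all of [rat]: countable
    unions need no side condition, and no path is read outside [0, p]. *)
Definition clip p (x : R) : R := Num.min (Num.max 0%R x) p.

Lemma clip_itv p x : (0 <= p)%R -> (0 <= clip p x <= p)%R.
Proof.
move=> p0; rewrite /clip.
by case: (leP 0%R x) => ?; [case: (leP x p) => ?|rewrite min_l//]; lra.
Qed.

Lemma clip_dist p u x : (0 <= u <= p)%R -> (`|u - clip p x| <= `|u - x|)%R.
Proof.
move=> /andP[u0 up]; rewrite /clip; have p0 := le_trans u0 up.
case: (leP 0%R x) => x0; last by rewrite min_l// !ger0_norm; lra.
by case: (leP x p) => xp//; rewrite !ler0_norm; lra.
Qed.

Lemma continuous_itv_dist T f u e : {within `[0%R, T], continuous f} ->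
  (0 <= u <= T)%R -> (0 < e)%R ->
  exists2 d : R, (0 < d)%R &
    forall v, (0 <= v <= T)%R -> (`|u - v| < d)%R -> (`|f u - f v| < e)%R.
Proof.
move=> /subspace_continuousP cf uT e0.
have /cvgrPdist_lt /(_ _ e0) := cf u (uT : (u \in `[0%R, T])).
rewrite near_withinE => /nbhs_ballP[d /= d0 H]; exists d => // v vT uv.
exact: H.
Qed.

(** Clipping does not increase the distance to a point of [0, p], so any rational close to [u] will
    do, endpoints included. *)
Lemma continuous_clip_rat T f p u e : {within `[0%R, T], continuous f} ->
  (p <= T)%R -> (0 <= u <= p)%R -> (0 < e)%R ->
  exists q : rat, (`|f u - f (clip p (ratr q))| < e)%R.
Proof.
move=> cf pT /andP[u0 up] e0.
have p0 : (0 <= p)%R by apply: le_trans up.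
have uT : (0 <= u <= T)%R by rewrite u0 (le_trans up).
have [d d0 H] := continuous_itv_dist cf uT e0.
have [q] : exists q : rat, ratr q \in `]u - d, u + d[%R.
  by apply: rat_in_itvoo; lra.
rewrite in_itv/= => qu; exists q; apply: H.
  have /andP[-> cp] := clip_itv (ratr q) p0; exact: le_trans pT.
apply: (@le_lt_trans _ _ `|u - ratr q|%R); first by apply: clip_dist; lra.
by rewrite ltr_norml; lra.
Qed.

End paths.

(** * The first zero is a stopping time *)

Section first_zero.
Context d {Omega : measurableType d} {R : realType}.
Variables (F : R -> set (set Omega)) (T : R) (Z : R -> Omega -> R).
Hypothesis Fnd : forall s t, (0 <= s)%R -> (s <= t)%R -> (t <= T)%R ->
  <<s F s >> `<=` <<s F t >>.
Hypothesis mZ : forall t, (0 <= t <= T)%R ->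
  measurable_fun [set: g_sigma_algebraType (F t)] (Z t).
Hypothesis cZ : continuous_paths T Z.

Let cZw w : {within `[0%R, T], continuous (Z^~ w)} := @cZ w.

Definition has_zero_before t :=
  [set w | exists2 u : R, (0 <= u <= t)%R & Z u w = 0%R].

(** The inclusion from right to left is compactness: |Z| attains its minimum on [0, t], and a
    positive minimum would exceed some 1/(n+1). The right side involves only countably many times,
    which gives measurability in [F t]. *)
Lemma has_zero_beforeE t : (0 <= t <= T)%R -> has_zero_before t =
  \bigcap_n \bigcup_(q : rat)
    [set w | (`|Z (clip t (ratr q)) w| < n.+1%:R^-1)%R].
Proof.
move=> /andP[t0 tT]; apply/seteqP; split => [w [u ut Zu] n _|w Hw].
  have n0 : (0 < n.+1%:R^-1 :> R)%R by rewrite invr_gt0.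
  have [q] := continuous_clip_rat (@cZw w) tT ut n0.
  by rewrite Zu sub0r normrN; exists q.
have ct : {within `[0%R, t], continuous (fun s => `|Z s w|%R)}.
  have ctZ : {within `[0%R, t], continuous (Z^~ w)}.
    apply: continuous_subspaceW (@cZw w) => x /=; rewrite !in_itv/=; lra.
  by move=> x; apply: continuous_comp; [exact: ctZ|exact: norm_continuous].
have [u] := EVT_min t0 ct; rewrite in_itv/= => ut minu.
exists u => //; apply/eqP; rewrite -normr_eq0; apply: contrapT => /negP Zu.
have [n nZ] : exists n, (n.+1%:R^-1 < `|Z u w|)%R.
  have Zu0 : (0 < `|Z u w|)%R by rewrite lt_def Zu normr_ge0.
  exists (Num.truncn `|Z u w|^-1); rewrite -[ltRHS]invrK.
  by rewrite ltf_pV2 ?posrE ?invr_gt0// truncnS_gt.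
have [q _ /=] := Hw n I.
have := minu (clip t (ratr q)); rewrite in_itv/= clip_itv// => /(_ isT).
by move=> /le_lt_trans/[apply]/(lt_trans nZ); rewrite ltxx.
Qed.

Lemma measurable_has_zero_before t : (0 <= t <= T)%R ->
  <<s F t >> (has_zero_before t).
Proof.
move=> tT; rewrite has_zero_beforeE//; have /andP[t0 tT'] := tT.
apply: (@bigcapT_measurable _ (g_sigma_algebraType (F t))) => n.
apply: (@bigcupT_measurable_rat _ (g_sigma_algebraType (F t))) => q.
have /andP[c0 ct] := clip_itv (ratr q) t0.
apply: (Fnd c0 ct tT').
have cT : (0 <= clip t (ratr q) <= T)%R by rewrite c0 (le_trans ct).
rewrite -[X in <<s _ >> X]setTI.
have := @measurable_fun_ltr _ (g_sigma_algebraType (F (clip t (ratr q)))) R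
  setT (fun w => `|Z (clip t (ratr q)) w|%R) (cst n.+1%:R^-1%R).
have mN := measurableT_comp (@normr_measurable R setT) (mZ cT).
move=> /(_ mN (measurable_cst _)) /(_ measurableT [set true]).
by apply.
Qed.

(** The infimum is attained by continuity: if Z is nonzero at t, it has no zero in some [t, t + e[,
    while an infimum <= t yields a zero below t + e, which must then be at most t. *)
Lemma first_zero_le t w : (0 <= t <= T)%R ->
  (first_zero T Z w <= t%:E) <-> has_zero_before t w.
Proof.
move=> /andP[t0 tT]; split; last first.
  move=> [u ut Zu]; apply: ge_ereal_inf; exists u%:E.
    by exists u => //; split => //; lra.
  by rewrite lee_fin; lra.
move=> ft.
have [Zt|/eqP Zt] := pselect (Z t w = 0%R); first by exists t => //; lra.
have tT' : (0 <= t <= T)%R by rewrite t0.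
have Zt0 : (0 < `|Z t w|)%R by rewrite normr_gt0.
have [e e0 H] := continuous_itv_dist (@cZw w) tT' Zt0.
have /ereal_inf_lt[_ [u [uT Zu] <-]] : first_zero T Z w < (t + e)%:E.
  by apply: le_lt_trans ft _; rewrite lte_fin; lra.
rewrite lte_fin => ute; exists u => //; apply/andP; split; first lra.
rewrite leNgt; apply/negP => tu.
have := H u uT; rewrite Zu subr0 ltxx => Hu.
by suff : false by []; apply: Hu; rewrite ltr_norml; lra.
Qed.

Lemma measurable_first_zero : (0 <= T)%R ->
  (forall t, (0 <= t <= T)%R -> <<s F t >> `<=` measurable) ->
  measurable_fun setT (first_zero T Z).
Proof.
move=> T0 FM.
apply: (measurability _ (ErealGenOInfty.measurableE R)).
move=> _ [_ [y ->] <-]; rewrite setTI.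
rewrite (_ : _ @^-1` _ = ~` [set w | first_zero T Z w <= y%:E]); last first.
  apply/seteqP; split => w /=; rewrite in_itv/= andbT ltNge.
    by move/negP.
  by move/negP.
apply: measurableC.
have [y0|y0] := ltP y 0%R.
  rewrite (_ : [set w | _] = set0)//; apply/seteqP; split => w //=.
  move=> wy; have : 0 <= first_zero T Z w.
    by apply: le_ereal_inf_tmp => _ [u [/andP[u0 _] _] <-]; rewrite lee_fin.
  by move=> /le_trans/(_ wy); rewrite lee_fin leNgt y0.
have [yT|Ty] := leP y T.
  have yT' : (0 <= y <= T)%R by rewrite y0.
  rewrite (_ : [set w | _] = has_zero_before y).
    exact: (FM _ yT' _ (measurable_has_zero_before yT')).
  by apply/seteqP; split => w H; apply/(first_zero_le w yT').
(* Finite values of [first_zero] lie in [0, T], so a level above [T] says no more than [T]. The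
   bound y + 1 below only serves to make the inequality strict, in order to extract a zero. *)
have TT : (0 <= T <= T)%R by rewrite T0 lexx.
rewrite (_ : [set w | _] = has_zero_before T).
  exact: (FM _ TT _ (measurable_has_zero_before TT)).
apply/seteqP; split => w /=; last first.
  by move=> /(first_zero_le w TT) /le_trans; apply; rewrite lee_fin ltW.
move=> wy.
have /ereal_inf_lt[_ [u [uT Zu] _] _] : first_zero T Z w < (y + 1)%:E.
  by apply: le_lt_trans wy _; rewrite lte_fin ltrDl.
by exists u.
Qed.

End first_zero.

(** * Absorption of the density process at zero *)

Section absorption.
Context d {Omega : measurableType d} {R : realType}.
Variables (P Q : probability Omega R) (F : R -> set (set Omega)) (T : R).
Variable (Z : R -> Omega -> R).
Hypothesis T_ge0 : (0 <= T)%R.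
Hypothesis FM : forall t, (0 <= t <= T)%R -> <<s F t >> `<=` measurable.
Hypothesis Fnd : forall s t, (0 <= s)%R -> (s <= t)%R -> (t <= T)%R ->
  <<s F s >> `<=` <<s F t >>.
Hypothesis mZ : forall t, (0 <= t <= T)%R ->
  measurable_fun [set: g_sigma_algebraType (F t)] (Z t).
Hypothesis ZQ : forall t, (0 <= t <= T)%R -> forall A, <<s F t >> A ->
  \int[P]_(w in A) (Z t w)%:E = Q A.
Hypothesis cZ : continuous_paths T Z.

Let TT : (0 <= T <= T)%R. Proof. by rewrite T_ge0 lexx. Qed.

Let below e := \bigcup_(q : rat) [set w | (Z (clip T (ratr q)) w < e)%R].

Let measurable_below1 e q :
  measurable [set w | (Z (clip T (ratr q)) w < e)%R].
Proof.
have cT := clip_itv (ratr q) T_ge0.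
rewrite -[X in measurable X]setTI.
have mm : measurable_fun setT (Z (clip T (ratr q))).
  exact: measurable_fun_sub (FM cT) (mZ cT).
have := measurable_fun_ltr mm (measurable_cst e) measurableT (Y := [set true]).
by apply.
Qed.

Let measurable_below e : measurable (below e).
Proof. exact: bigcupT_measurable_rat. Qed.

(** The finite inequality is applied to growing finite sets of times and passes to the limit by
    continuity of [Q] from below; the factor [P (S n)] is at most 1. *)
Let Q_below_le e : (0 < e)%R -> Q (below e) <= e%:E.
Proof.
move=> e0.
(* The clipped rationals with code below n, sorted as the finite inequality requires; [pmap] skips
   integers that code no rational. *)
pose s n : seq R :=
  sort <=%R [seq clip T (ratr q) | q <- pmap (@unpickle rat) (iota 0 n)].
pose S n := [set w | exists2 q, q \in s n & (Z q w < e)%R].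
have sE n x : (x \in s n) =
    (x \in [seq clip T (ratr q) | q <- pmap (@unpickle rat) (iota 0 n)]).
  by rewrite mem_sort.
have sT n q : q \in s n -> (0 <= q <= T)%R.
  by rewrite sE => /mapP[r _ ->]; exact: clip_itv.
have mS n : measurable (S n).
  exact: (FM TT (measurable_finite_hit Fnd mZ e TT (sT n))).
have US : \bigcup_n S n = below e.
  apply/seteqP; split => [w [n _ [_ /[!sE]/mapP[q _ ->] qe]]|w [q _ qe]].
    by exists q.
  exists (pickle q).+1 => //; exists (clip T (ratr q)) => //.
  rewrite sE; apply: map_f; rewrite mem_pmap; apply/mapP.
  exists (pickle q); first by rewrite mem_iota/= add0n ltnSn.
  by rewrite pickleK.
have ndS : {homo S : n m / (n <= m)%N >-> (n <= m)%O}.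
  move=> n m nm; apply/subsetPset => w [q qs qe]; exists q => //.
  move: qs; rewrite !sE => /mapP[r rs ->]; apply: map_f.
  move: rs; rewrite !mem_pmap => /mapP[i] /[!mem_iota]/= ni ri.
  apply/mapP; exists i => //; rewrite mem_iota/=.
  by rewrite (leq_trans ni)// !add0n.
rewrite -US.
have := nondecreasing_cvg_mu mS (bigcupT_measurable _ mS) ndS (mu := Q).
move=> /cvge_to_le; apply; apply: nearW => n /=.
have srt : pairwise <=%R (s n).
  by rewrite -sorted_pairwise; [exact: sort_le_sorted|exact: le_trans].
apply: (@le_trans _ _ (e%:E * P (S n))).
  exact: (finite_hit_le FM Fnd mZ ZQ e0 srt (sT n)).
by rewrite -[leRHS]mule1 lee_wpmul2l ?probability_le1 ?lee_fin ?ltW.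
Qed.

(** A path with a value <= 0 belongs to [below e] for every e > 0, by continuity at that point, and
    [below e] has [Q]-measure at most e. *)
Lemma density_ae_gt0 :
  {ae Q, forall w u, (0 <= u <= T)%R -> (0 < Z u w)%R}.
Proof.
exists (\bigcap_n below (n.+1%:R^-1)%R); split.
- exact: bigcapT_measurable.
- apply/eqP; rewrite eq_le measure_ge0 andbT.
  apply/lee_addgt0Pr => e e0; rewrite add0e.
  apply: (@le_trans _ _ (Q (below ((Num.truncn e^-1%R).+1%:R^-1)%R))).
    apply: le_measure; rewrite ?inE//; first exact: bigcapT_measurable.
    exact: bigcap_inf.
  apply: (le_trans (Q_below_le _)); rewrite ?invr_gt0//.
  rewrite lee_fin -[leRHS]invrK ler_pV2 ?inE ?unitfE ?invr_eq0 ?gt_eqF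
    ?invr_gt0//=.
  by rewrite ltW// truncnS_gt.
- move=> w /= /existsNP[u /not_implyP[uT /negP]]; rewrite -leNgt => Zu n _.
  have n0 : (0 < n.+1%:R^-1 :> R)%R by rewrite invr_gt0.
  have [q Hq] := continuous_clip_rat (@cZ w) (lexx T) uT n0.
  exists q => //=; move: Hq; rewrite /= ltr_norml => /andP[+ _].
  by rewrite ltrNl opprB ltrBlDr => /lt_le_trans; apply; rewrite gerDl.
Qed.

(** The event on the left lies in [F t] and is [Q]-null by the previous lemma, so the integral over
    it of the positive part of [Z t] is 0. *)
Lemma density_absorbed t : (0 <= t <= T)%R ->
  {ae P, forall w, has_zero_before Z t w -> Num.max (Z t w) 0%R = 0%R}.
Proof.
move=> tT; have FH := measurable_has_zero_before Fnd mZ cZ tT.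
have mH := FM tT FH.
have QH : Q (has_zero_before Z t) = 0.
  apply/negligibleP => //.
  apply: negligibleS density_ae_gt0 => w [u ut Zu] /(_ u) /=.
  by rewrite Zu ltxx => H; suff : false by []; apply: H; lra.
exact: null_density_max0 (FM tT) (mZ tT) (ZQ tT) _ FH QH.
Qed.

End absorption.

(** The inverse is the difference of the powers of exponent -1 of the positive and negative parts;
    this holds at 0 as well because both [invr] and this power send 0 to 0. *)
Lemma measurable_invr (R : realType) :
  measurable_fun [set: R] (fun x : R => x^-1)%R.
Proof.
rewrite (_ : (fun x : R => x^-1)%R =
    (fun x => (Num.max x 0) `^ (-1) - (Num.max (- x) 0) `^ (-1)))%R.
  apply: measurable_funB; apply: (measurableT_comp (@measurable_powR R _)).
    exact: measurable_maxr.
  by apply: measurable_maxr => //; exact: measurableT_comp.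
apply/funext => x; rewrite !powR_inv1 ?le_max ?lexx ?orbT//.
case: (leP 0%R x) => x0.
  by rewrite (@max_r _ _ (- x)%R) ?oppr_le0// invr0 subr0.
by rewrite max_l ?oppr_ge0 ?ltW// invr0 sub0r invrN opprK.
Qed.

(** Tonelli applied to the positive and negative parts covers signed integrands, such as the
    interest rate, with no integrability. *)
Lemma measurable_fun_param_integral d (S : measurableType d) (R : realType)
    (f : S * measurableTypeR R -> \bar R) : measurable_fun setT f ->
  measurable_fun setT (fun x => \int[@lebesgue_measure R]_y f (x, y)).
Proof.
move=> mf.
have mp := @measurable_fun_fubini_tonelli_F _ _ S (measurableTypeR R) R
  lebesgue_measure (f^\+)%E (measurable_funepos mf) (@funepos_ge0 _ _ f).
have mn := @measurable_fun_fubini_tonelli_F _ _ S (measurableTypeR R) R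
  lebesgue_measure (f^\-)%E (measurable_funeneg mf) (@funeneg_ge0 _ _ f).
have := emeasurable_funB mp mn.
congr (measurable_fun _ _); apply/funext => x; rewrite [RHS]integralE.
by congr (_ - _); apply: eq_integral => y _; rewrite ?funeposE ?funenegE.
Qed.

(** * Progressive measurability of continuous processes and time integrals *)

Section progressive.
Context d {Omega : measurableType d} {R : realType}.
Variables (F : R -> set (set Omega)) (T : R).
Hypothesis FM : forall t, (0 <= t <= T)%R -> <<s F t >> `<=` measurable.
Hypothesis Fnd : forall s t, (0 <= s)%R -> (s <= t)%R -> (t <= T)%R ->
  <<s F s >> `<=` <<s F t >>.
Implicit Types Y : R -> Omega -> R.

Let measurable_window (t : R) :
  measurable (`[0%R, t] `*` [set: g_sigma_algebraType (F t)] :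
    set (measurableTypeR R * g_sigma_algebraType (F t))).
Proof. by apply: measurableX => //; exact: measurable_itv. Qed.

Lemma progressive_adapted Y : progressively_measurable F T Y -> adapted F T Y.
Proof.
move=> pY t tT.
have /(measurable_restrictT _ (@measurable_window t)) mY := pY t tT.
have := measurable_fun_pair2 (t : measurableTypeR R) mY.
congr (measurable_fun _ _); apply/funext => w /=.
rewrite patchE ifT// inE; split => //=.
by rewrite in_itv/=; have /andP[-> _] := tT; rewrite lexx.
Qed.

Lemma progressive_joint Y : (0 <= T)%R -> progressively_measurable F T Y ->
  measurable_fun (`[0%R, T] `*` [set: Omega])
    (fun p : measurableTypeR R * Omega => Y p.1 p.2).
Proof.
move=> T0 pY; have TT : (0 <= T <= T)%R by rewrite T0 lexx.
have /(measurable_restrictT _ (@measurable_window T)) mY := pY T TT.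
apply/measurable_restrictT.
  by apply: measurableX => //; exact: measurable_itv.
have mi : measurable_fun [set: measurableTypeR R * Omega]
    (fun p => (p.1, p.2) : measurableTypeR R * g_sigma_algebraType (F T)).
  apply: measurable_fun_pair => //.
  exact: (measurableT_comp (measurable_id_sub (FM TT)) measurable_snd).
have := measurableT_comp mY mi.
congr (measurable_fun _ _); apply/funext => -[s w]; by rewrite /= !patchE.
Qed.

(** On [0, t], [Y] is the limit of its values at the times s rounded down to multiples of 1/(n+1).
    Each approximation reads countably many times, so adaptedness makes it jointly measurable, and
    continuity gives the convergence. *)
Lemma continuous_adapted_progressive Y : continuous_paths T Y ->
  adapted F T Y -> progressively_measurable F T Y.
Proof.
move=> cY aY t /andP[t0 tT].
(* For s in [0, t] the rounded time is already there; the clip matters for s > t, so that only times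
   in [0, t], hence events of [F t], are involved. Negative s are truncated to 0. *)
pose g n (s : R) : R := clip t ((Num.truncn (s * n.+1%:R)%R)%:R / n.+1%:R)%R.
apply: (@measurable_fun_cvg _ (measurableTypeR R * g_sigma_algebraType (F t))%type
  R _ (fun n p => Y (g n p.1) p.2)).
- move=> n; apply: measurable_funTS => _ B mB; rewrite setTI.
  pose A k := [set s : measurableTypeR R | Num.truncn (s * n.+1%:R)%R = k].
  have mA k : measurable (A k).
    have mle l : measurable
        [set s : measurableTypeR R | (Num.truncn (s * n.+1%:R)%R <= l)%N].
      under eq_set do rewrite truncn_le_nat.
      rewrite -[X in measurable X]setTI.
      have mM : measurable_fun [set: measurableTypeR R]
          (fun s : R => s * n.+1%:R)%R by exact: measurable_funM.
      have := measurable_fun_ltr mM (measurable_cst (l.+1%:R : R)) measurableT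
        (Y := [set true]).
      by apply.
    case: k => [|k].
      rewrite (_ : A 0%N = [set s | (Num.truncn (s * n.+1%:R)%R <= 0)%N])//.
      by apply/seteqP; split => s; rewrite /A /= leqn0 => /eqP.
    rewrite (_ : A k.+1 = [set s | (Num.truncn (s * n.+1%:R)%R <= k.+1)%N] `\`
        [set s | (Num.truncn (s * n.+1%:R)%R <= k)%N]).
      exact: measurableD.
    apply/seteqP; split => s /=; first by rewrite /A /= => ->; rewrite ltnn.
    by move=> [sk /negP]; rewrite -ltnNge => ks; apply/eqP; rewrite eqn_leq sk.
  rewrite (_ : _ @^-1` B = \bigcup_k
      (A k `*` (Y (clip t (k%:R / n.+1%:R)%R) @^-1` B))); last first.
    apply/seteqP; split => [[s w] /= sw|[s w] [k _ [/= <-]]]//.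
    by exists (Num.truncn (s * n.+1%:R)%R).
  apply: bigcupT_measurable => k; apply: measurableX => //.
  have /andP[c0 ct] := clip_itv (k%:R / n.+1%:R)%R t0.
  have := @aY (clip t (k%:R / n.+1%:R)%R).
  rewrite c0 (le_trans ct)// => /(_ isT measurableT B mB); rewrite setTI.
  exact: (Fnd c0 ct tT).
- move=> [s w] [/= + _]; rewrite in_itv/= => st.
  apply/cvgrPdist_lt => e e0.
  have sT : (0 <= s <= T)%R by lra.
  have [dl dl0 H] := continuous_itv_dist (@cY w) sT e0.
  near=> n.
  apply: H.
    have /andP[-> ct] := clip_itv ((Num.truncn (s * n.+1%:R)%R)%:R / n.+1%:R)%R t0.
    exact: le_trans tT.
  apply: (le_lt_trans (clip_dist _ st)).
  have n0 : (0 < n.+1%:R :> R)%R by [].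
  have s0 : (0 <= s * n.+1%:R)%R by rewrite mulr_ge0//; lra.
  have /andP[tl tu] := truncn_itv s0.
  apply: (@le_lt_trans _ _ (n.+1%:R^-1)%R).
    rewrite ger0_norm; last by rewrite subr_ge0 ler_pdivrMr.
    rewrite lerBlDr -[X in (X + _)%R]mul1r -mulrDl ler_pdivlMr//.
    by rewrite addrC natr1 ltW.
  rewrite -[ltRHS]invrK ltf_pV2 ?posrE ?invr_gt0//.
  near: n; apply: filterS (nbhs_infty_gtr (dl^-1)%R) => m dm.
  by apply: lt_le_trans dm _; rewrite ler_nat.
Unshelve. all: by end_near. Qed.

Lemma progressive_Rintegral Y : progressively_measurable F T Y ->
  progressively_measurable F T
    (fun t w => \int[lebesgue_measure]_(s in `[0%R, t[) Y s w)%R.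
Proof.
move=> pY t tT.
have /(measurable_restrictT _ (@measurable_window t)) mY := pY t tT.
set f := (X in measurable_fun _ X) in mY.
pose RG : measurableType _ := (measurableTypeR R * g_sigma_algebraType (F t))%type.
(* Here p.1 is the pair (s, w) and p.2 the integration variable. The moving upper bound s becomes
   part of the integrand; the lower bound 0 comes from [f], which vanishes off the window. *)
pose k (p : RG * measurableTypeR R) :=
  (if (p.2 < p.1.1)%R then f (p.2, p.1.2) else 0%R).
have mk : measurable_fun setT (fun p => (k p)%:E).
  apply/measurable_EFinP; apply: measurable_fun_ifT => //.
  - apply: measurable_fun_ltr => //.
    exact: (measurableT_comp measurable_fst measurable_fst).
  - apply: (measurableT_comp mY); apply: measurable_fun_pair => //.
    exact: (measurableT_comp measurable_snd measurable_fst).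
have := measurable_fun_param_integral mk.
move=> /(measurableT_comp (fine_measurable measurableT)).
move=> /(measurable_funTS (D := `[0%R, t] `*` setT)).
apply: eq_measurable_fun => -[s w]; rewrite inE => -[/= + _].
rewrite in_itv/= => /andP[s0 st].
rewrite /Rintegral; congr fine; rewrite [RHS]integral_mkcond.
apply: eq_integral => u _; rewrite /k /= /f patchE /=.
rewrite patchE mem_setE in_itv/=.
case: (ltP u s) => us; last by rewrite andbF.
have [u0|u0] := leP 0%R u => /=.
  by rewrite ifT// inE; split => //=; rewrite in_itv/= u0 (le_trans (ltW us)).
rewrite ifF//; apply/negbTE; rewrite notin_setE => -[] /=.
by rewrite in_itv/= leNgt u0.
Qed.

End progressive.

Section parametric_integrals.
Context d {Omega : measurableType d} {R : realType}.
Implicit Types f : measurableTypeR R * Omega -> \bar R.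

Lemma measurable_fun_param_integral_in f (D : set (measurableTypeR R)) :
  measurable D -> measurable_fun setT f ->
  measurable_fun setT (fun w => \int[@lebesgue_measure R]_(s in D) f (s, w)).
Proof.
move=> mD mf.
have mTD : measurable ([set: Omega] `*` D) by exact: measurableX.
have mf' : measurable_fun setT (fun p : Omega * measurableTypeR R => f (p.2, p.1)).
  by apply: (measurableT_comp mf); exact: measurable_fun_pair.
have := (measurable_restrictT _ mTD).1 (measurable_funTS mf').
move=> /measurable_fun_param_integral.
congr (measurable_fun _ _); apply/funext => w; rewrite [RHS]integral_mkcond.
by apply: eq_integral => s _; rewrite !patchE in_setX in_setT.
Qed.

Lemma ge0_integral_exchange (mu : probability Omega R) f
    (D : set (measurableTypeR R)) (A : set Omega) :
  measurable D -> measurable A -> measurable_fun setT f ->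
  (forall p, 0 <= f p) ->
  \int[mu]_(w in A) \int[@lebesgue_measure R]_(s in D) f (s, w) =
  \int[@lebesgue_measure R]_(s in D) \int[mu]_(w in A) f (s, w).
Proof.
move=> mD mA mf f0.
have mDA : measurable (D `*` A) by exact: measurableX.
have mg := (measurable_restrictT _ mDA).1 (measurable_funTS mf).
have g0 p : 0 <= (f \_ (D `*` A)) p by apply: erestrict_ge0 => *; exact: f0.
have gE s w : (f \_ (D `*` A)) (s, w) =
    if (s \in D) && (w \in A) then f (s, w) else 0.
  by rewrite patchE in_setX.
transitivity (\int[mu]_w \int[@lebesgue_measure R]_s (f \_ (D `*` A)) (s, w)).
  rewrite integral_mkcond; apply: eq_integral => w _; rewrite patchE.
  have [wA|wA] := boolP (w \in A).
    rewrite [LHS]integral_mkcond; apply: eq_integral => s _.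
    by rewrite gE wA andbT patchE.
  by rewrite integral0_eq// => s _; rewrite gE (negbTE wA) andbF.
rewrite -(@fubini_tonelli _ _ (measurableTypeR R) Omega R lebesgue_measure mu
  _ mg g0).
rewrite [RHS]integral_mkcond; apply: eq_integral => s _; rewrite patchE.
have [sD|sD] := boolP (s \in D).
  rewrite [RHS]integral_mkcond; apply: eq_integral => w _.
  by rewrite gE sD [RHS]patchE.
by rewrite integral0_eq// => w _; rewrite gE (negbTE sD).
Qed.

End parametric_integrals.

(** * Signs of conditional expectations *)

Section conditional_expectation.
Context d {Omega : measurableType d} {R : realType}.
Variables (P : probability Omega R) (G : set (set Omega)).
Hypothesis GM : <<s G >> `<=` measurable.
Variables Y W : Omega -> \bar R.
Hypothesis YW : cond_expectation P G Y W.

(** The sign condition bears on integrals of [Y], not on [Y]: the time integral of xi c / Z may be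
    negative on a [Q]-null set, where Z is. *)
Lemma cond_expectation_ae_ge0 :
  (forall A, <<s G >> A -> 0 <= \int[P]_(w in A) Y w) ->
  {ae P, forall w, 0 <= W w}.
Proof.
move=> Y0; case: YW => mW WY.
by apply: (sub_ae_ge0 GM mW) => A GA; rewrite WY//; exact: Y0.
Qed.

Lemma integral_cond_expectation_max0 A :
  (forall A, <<s G >> A -> 0 <= \int[P]_(w in A) Y w) -> <<s G >> A ->
  \int[P]_(w in A) maxe (W w) 0 = \int[P]_(w in A) Y w.
Proof.
move=> Y0 GA; case: (YW) => mW <-//; apply: ae_eq_integral => //.
- exact: GM.
- apply: measurable_funTS; apply: measurable_maxe => //.
  exact: measurable_fun_sub mW.
- by apply: measurable_funTS; exact: measurable_fun_sub mW.
- by move: (cond_expectation_ae_ge0 Y0); apply: filterS => w W0 _; rewrite max_l.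
Qed.

End conditional_expectation.

(** * The decomposition for an abstract integrand *)

Section decomposition.
Context d {Omega : measurableType d} {R : realType}.
Variables (P Q : probability Omega R) (F : R -> set (set Omega)) (T : R).
Variable (Z : R -> Omega -> R).
Hypothesis T_ge0 : (0 <= T)%R.
Hypothesis FM : forall t, (0 <= t <= T)%R -> <<s F t >> `<=` measurable.
Hypothesis Fnd : forall s t, (0 <= s)%R -> (s <= t)%R -> (t <= T)%R ->
  <<s F s >> `<=` <<s F t >>.
Hypothesis QP : Q `<< P.
Hypothesis mZ : forall t, (0 <= t <= T)%R ->
  measurable_fun [set: g_sigma_algebraType (F t)] (Z t).
Hypothesis ZQ : forall t, (0 <= t <= T)%R -> forall A, <<s F t >> A ->
  \int[P]_(w in A) (Z t w)%:E = Q A.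
Hypothesis cZ : continuous_paths T Z.

(* h plays the role of xi c and iz that of 1 / Z. *)
Variables (h iz : measurableTypeR R * Omega -> R).
Hypothesis mh : measurable_fun setT h.
Hypothesis h_ge0 : forall p, (0 <= h p)%R.
Hypothesis ah : forall s, (0 <= s <= T)%R ->
  measurable_fun [set: g_sigma_algebraType (F s)] (fun w => h (s, w)).
Hypothesis miz : measurable_fun setT iz.
Hypothesis izE : forall s w, (0 <= s <= T)%R -> iz (s, w) = ((Z s w)^-1)%R.

Variable t : R.
Hypothesis tT : (0 <= t <= T)%R.

Notation leb := (@lebesgue_measure R).
Notation tau := (first_zero T Z).

Let mtau : measurable_fun setT tau.
Proof. exact: (measurable_first_zero Fnd mZ cZ T_ge0 FM). Qed.

Let alive (p : measurableTypeR R * Omega) := (p.1%:E < tau p.2).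

Let malive : measurable_fun setT alive.
Proof.
apply: measurable_fun_lte; first exact: measurableT_comp.
exact: measurableT_comp.
Qed.

(** [ha] and [hd] split [h] into its parts before [tau] and from [tau] on, over fixed time
    domains. *)
Let ha p := if alive p then (h p)%:E else 0.
Let hd p := if alive p then 0 else (h p)%:E.

Let mEh : measurable_fun setT (EFin \o h).
Proof. exact: measurableT_comp. Qed.

Let mha : measurable_fun setT ha.
Proof. exact: measurable_fun_ifT. Qed.

Let mhd : measurable_fun setT hd.
Proof. exact: measurable_fun_ifT. Qed.

Let ha_ge0 p : 0 <= ha p.
Proof. by rewrite /ha; case: ifP; rewrite ?lee_fin. Qed.

Let hd_ge0 p : 0 <= hd p.
Proof. by rewrite /hd; case: ifP; rewrite ?lee_fin. Qed.

Let itv_sub s : `[t, T[%classic s -> (0 <= s <= T)%R.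
Proof. by rewrite /= in_itv/=; move: tT; lra. Qed.

Let mI : measurable (`[t, T[%classic : set (measurableTypeR R)).
Proof. exact: measurable_itv. Qed.

Let Y1 w := \int[leb]_(s in `[t, T[) (h (s, w) * iz (s, w))%:E.
(** The absolute value makes the integrand nonnegative everywhere, as Tonelli requires; it changes
    nothing [Q]-a.s., where Z > 0 at all times. *)
Let Y1' w := \int[leb]_(s in `[t, T[) (h (s, w) * `|iz (s, w)|)%:E.

Let Y1_ae : {ae Q, forall w, Y1 w = Y1' w}.
Proof.
move: (density_ae_gt0 T_ge0 FM Fnd mZ ZQ cZ); apply: filterS => w Zw.
apply: eq_integral => s; rewrite inE => /itv_sub sT.
by rewrite izE// ger0_norm// invr_ge0 ltW// Zw.
Qed.

Let mhz : measurable_fun setT (fun p => (h p * `|iz p|)%:E).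
Proof.
apply/measurable_EFinP; apply: measurable_funM => //.
exact: measurableT_comp.
Qed.

Let hz_ge0 p : 0 <= (h p * `|iz p|)%:E.
Proof. by rewrite lee_fin mulr_ge0. Qed.

Let Y1_Y1' A : measurable A ->
  \int[Q]_(w in A) Y1 w = \int[Q]_(w in A) Y1' w.
Proof.
move=> mA; apply: ae_eq_integral => //.
- apply: measurable_funTS; apply: (measurable_fun_param_integral_in
    (f := fun p => (h p * iz p)%:E)) => //.
  by apply/measurable_EFinP; exact: measurable_funM.
- apply: measurable_funTS; exact: (measurable_fun_param_integral_in
    (f := fun p => (h p * `|iz p|)%:E)).
- by move: Y1_ae; apply: filterS => w + _.
Qed.

(** The set [A] is also in [F s], so [Q] may be replaced by the density at time s. Before [tau] the
    factors 1/Z and Z cancel, since Z is nonzero; from [tau] on, absorption makes the density 0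
    [P]-a.e. *)
Let change_at s A : `[t, T[%classic s -> <<s F t >> A ->
  \int[Q]_(w in A) (h (s, w) * `|iz (s, w)|)%:E = \int[P]_(w in A) ha (s, w).
Proof.
move=> sI FtA; have sT := itv_sub sI.
have ts : (t <= s)%R by move: sI; rewrite /= in_itv/= => /andP[].
have FA : <<s F s >> A.
  by have /andP[t0 _] := tT; have /andP[_ sT'] := sT; exact: (Fnd t0 ts sT').
rewrite (@ge0_change_of_measure _ _ _ P Q (F s) (Z s))//; last 4 first.
- exact: FM.
- exact: mZ.
- by move=> B; exact: ZQ.
- apply/measurable_EFinP.
  apply: (@measurable_funM _ (g_sigma_algebraType (F s))); first exact: ah.
  apply: (@measurableT_comp _ _ _ (g_sigma_algebraType (F s))) => //.
  rewrite (_ : (fun w => iz (s, w)) = (fun w => (Z s w)^-1%R)).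
    exact: (measurableT_comp (@measurable_invr R) (mZ sT)).
  by apply/funext => w; rewrite izE.
apply: ge0_ae_eq_integral.
- exact: (FM tT).
- apply: measurable_funTS; apply: emeasurable_funM.
    exact: (measurableT_comp mhz).
  apply/measurable_EFinP; apply: measurable_maxr => //.
  exact: (measurable_fun_sub (FM sT) (mZ sT)).
- by apply: measurable_funTS; exact: (measurableT_comp mha).
- by move=> w _; apply: mule_ge0; rewrite // lee_fin le_max lexx orbT.
- by [].
have := density_absorbed T_ge0 FM Fnd mZ ZQ cZ sT.
have := density_ae_ge0 (FM sT) (mZ sT) (ZQ sT).
apply: filterS2 => w Z0 ab wA; rewrite /ha /alive /= ltNge.
have [ts'|ts'] := boolP (tau w <= s%:E) => /=.
  by rewrite ab ?mule0//; apply/(first_zero_le cZ w sT).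
rewrite izE// -EFinM -mulrA max_l// ger0_norm ?invr_ge0// mulVf ?mulr1//.
apply/eqP => Zw; move/negP : ts'; apply; apply/(first_zero_le cZ w sT).
by exists s => //; have /andP[-> _] := sT; rewrite lexx.
Qed.

Let integral_Y1 A : <<s F t >> A ->
  \int[Q]_(w in A) Y1 w = \int[P]_(w in A) \int[leb]_(s in `[t, T[) ha (s, w).
Proof.
move=> FA; have mA := FM tT FA; rewrite Y1_Y1'//.
rewrite (ge0_integral_exchange Q mI mA mhz hz_ge0).
rewrite (ge0_integral_exchange P mI mA mha ha_ge0).
by apply: eq_integral => s; rewrite inE => sI; exact: change_at.
Qed.

Let Y0 w := \int[leb]_(s in `[t, T[) (h (s, w))%:E.
Let YD w := \int[leb]_(s in [set s | tau w <= s%:E < T%:E]) (h (s, w))%:E.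

(** The random domain of integration is traded for a fixed one, which makes [YD] measurable in w. No
    lower bound is needed because [hd] vanishes before [tau]. *)
Let YDE w : YD w = \int[leb]_(s in `]-oo, T[) hd (s, w).
Proof.
rewrite /YD integral_mkcond [RHS]integral_mkcond.
apply: eq_integral => s _; rewrite !patchE [in RHS]mem_setE in_itv/=.
rewrite (_ : (s \in _) = (tau w <= s%:E) && (s < T)%R); last first.
  by apply/idP/idP; rewrite inE/= lte_fin.
by rewrite /hd /alive /= (ltNge s%:E); case: (tau w <= s%:E); case: (s < T)%R.
Qed.

Let mYD : measurable_fun setT YD.
Proof.
by rewrite (funext YDE); exact: measurable_fun_param_integral_in.
Qed.

Let Y0_split w : t%:E < tau w ->
  Y0 w = \int[leb]_(s in `[t, T[) ha (s, w) + YD w.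
Proof.
(* Times before t are also before [tau w], so [hd] vanishes there and the domain can be cut at t. *)
move=> tw; have -> : YD w = \int[leb]_(s in `[t, T[) hd (s, w).
  rewrite YDE integral_mkcond [RHS]integral_mkcond.
  apply: eq_integral => s _; rewrite !patchE !mem_setE !in_itv/= /hd /alive.
  case: (leP t s) => //= st.
  by rewrite (lt_trans _ tw) ?lte_fin// if_same.
rewrite -ge0_integralD//.
- apply: eq_integral => s _; rewrite /ha /hd.
  by case: (alive _); rewrite ?adde0 ?add0e.
- by apply: measurable_funTS; exact: (measurable_fun_pair1 _ mha).
- by apply: measurable_funTS; exact: (measurable_fun_pair1 _ mhd).
Qed.

(** The sign conclusions accompany the identity because the final multiplication by 1 / xi_t must
    distribute over a sum of extended reals. *)
Lemma cond_expectation_decomposition (W0 W1 W : Omega -> \bar R) :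
  cond_expectation P (F t) Y0 W0 -> cond_expectation Q (F t) Y1 W1 ->
  cond_expectation P (F t) YD W ->
  {ae P, forall w, t%:E < tau w ->
    [/\ (0 < Z t w)%R, 0 <= W1 w, 0 <= W w &
        W0 w = (Z t w)%:E * W1 w + W w]}.
Proof.
move=> cW0 cW1 cW.
have GM := FM tT.
have Y0_ge0 A : <<s F t >> A -> 0 <= \int[P]_(w in A) Y0 w.
  move=> _; apply: integral_ge0 => w _; apply: integral_ge0 => s _.
  by rewrite lee_fin.
have Y1_ge0 A : <<s F t >> A -> 0 <= \int[Q]_(w in A) Y1 w.
  by move=> /integral_Y1 ->; apply: integral_ge0 => w _; exact: integral_ge0.
have YD_ge0 A : <<s F t >> A -> 0 <= \int[P]_(w in A) YD w.
  move=> _; apply: integral_ge0 => w _; apply: integral_ge0 => s _.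
  by rewrite lee_fin.
pose D := ~` has_zero_before Z t.
have FH := measurable_has_zero_before Fnd mZ cZ tT.
have FD : <<s F t >> D by exact: (@measurableC _ (g_sigma_algebraType (F t))).
have tauD w : t%:E < tau w <-> D w.
  rewrite ltNge; split => [/negP tw /(first_zero_le cZ w tT)//|Dw].
  by apply/negP => /(first_zero_le cZ w tT).
pose z w := (Num.max (Z t w) 0)%:E.
have z_ge0 w : 0 <= z w by rewrite lee_fin le_max lexx orbT.
have mz : measurable_fun [set: g_sigma_algebraType (F t)] z.
  by apply/measurable_EFinP; apply: measurable_maxr => //; exact: mZ.
have mmax (V : Omega -> \bar R) : measurable_fun [set: g_sigma_algebraType (F t)] V ->
    measurable_fun [set: g_sigma_algebraType (F t)] (fun w => maxe (V w) 0).
  by move=> mV; exact: (@measurable_maxe _ (g_sigma_algebraType (F t))).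
have max_ge0 (V : Omega -> \bar R) w : 0 <= maxe (V w) 0.
  by rewrite le_max lexx orbT.
have mzW1 : measurable_fun [set: g_sigma_algebraType (F t)]
    (fun w => maxe (W1 w) 0 * z w).
  by apply: (@emeasurable_funM _ (g_sigma_algebraType (F t))) => //; apply: mmax cW1.1.
have mha' : measurable_fun setT (fun w => \int[leb]_(s in `[t, T[) ha (s, w)).
  exact: measurable_fun_param_integral_in.
(* Positive parts are compared, so that uniqueness applies to functions nonnegative everywhere. They
   have the integrals of the original versions, under [Q] for [W1] and under [P] for the others. *)
have key : {ae P, forall w, D w ->
    maxe (W0 w) 0 = maxe (W1 w) 0 * z w + maxe (W w) 0}.
  apply: (ge0_sub_ae_eq GM FD) => //.
  - exact: mmax cW0.1.
  - apply: (@emeasurable_funD _ (g_sigma_algebraType (F t))) => //.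
    exact: mmax cW.1.
  - by move=> w; rewrite adde_ge0// mule_ge0.
  - move=> A AD FA; have mA := GM _ FA.
    rewrite (integral_cond_expectation_max0 GM cW0)//.
    rewrite [RHS]ge0_integralD//; last 3 first.
    + by move=> w _; rewrite mule_ge0.
    + by apply: measurable_funTS; exact: measurable_fun_sub mzW1.
    + by apply: measurable_funTS; apply: measurable_fun_sub GM _; exact: mmax cW.1.
    rewrite (integral_cond_expectation_max0 GM cW)//.
    have <- := ge0_change_of_measure GM QP (mZ tT) (ZQ tT) FA (mmax _ cW1.1)
      (max_ge0 W1).
    rewrite (integral_cond_expectation_max0 GM cW1)// integral_Y1//.
    rewrite -ge0_integralD//; last 4 first.
    + by move=> w _; exact: integral_ge0.
    + exact: measurable_funTS.
    + by move=> w _; apply: integral_ge0 => s _; rewrite lee_fin.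
    + exact: measurable_funTS.
    by apply: eq_integral => w; rewrite inE => /AD /tauD; exact: Y0_split.
(* Under [Q] alone [W1] is known to be nonnegative a.e. The set where it is negative is a [Q]-null
   set of [F t], so [P]-a.e. on it Z_t <= 0: the sign carries over to [P] where Z_t > 0. *)
have W1_ge0 : {ae P, forall w, (0 < Z t w)%R -> 0 <= W1 w}.
  have FN : <<s F t >> [set w | W1 w < 0].
    rewrite -[X in <<s _ >> X]setTI.
    exact: (@measurable_lte _ (g_sigma_algebraType (F t)) R setT measurableT W1
      (cst 0) cW1.1).
  have QN : Q [set w | W1 w < 0] = 0.
    apply/negligibleP; first exact: GM.
    apply: negligibleS (cond_expectation_ae_ge0 GM cW1 Y1_ge0).
    by move=> w /= W1w; apply/negP; rewrite -ltNge.
  move: (null_density_max0 GM (mZ tT) (ZQ tT) FN QN); apply: filterS => w /= H Zw.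
  rewrite leNgt; apply/negP => /H; rewrite max_l ?ltW// => Z0.
  by move: Zw; rewrite Z0 ltxx.
move: key W1_ge0 (density_ae_ge0 GM (mZ tT) (ZQ tT))
  (cond_expectation_ae_ge0 GM cW0 Y0_ge0) (cond_expectation_ae_ge0 GM cW YD_ge0).
move=> H1 H2 H3 H4 H5.
apply: filterS2 (filterI H1 H2) (filterI H3 (filterI H4 H5)).
move=> w /= [k W1w] [Z0 [W0w Ww]] /tauD Dw.
have Zw : (0 < Z t w)%R.
  rewrite lt_def Z0 andbT; apply/negP => /eqP Zw; apply: Dw; exists t => //.
  by have /andP[-> _] := tT; rewrite lexx.
split => //; first exact: W1w.
by have := k Dw; rewrite /z (max_l W0w) (max_l Ww) (max_l (W1w Zw)) (max_l Z0) muleC.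
Qed.

End decomposition.

(** * The Brownian filtration and the state price density *)

Section brownian_filtration.
Context d {Omega : measurableType d} {R : realType}.
Variables (P : probability Omega R) (n : nat) (X : 'I_n -> R -> Omega -> R).

Lemma augmented_past_measurable (T t : R) :
  (forall i s, (0 <= s <= T)%R -> measurable_fun setT (X i s)) ->
  (t <= T)%R -> <<s augmented_past P X t >> `<=` measurable.
Proof.
move=> mX tT; apply: smallest_sub; first exact: sigma_algebra_measurable.
move=> A [[i [s [B [/andP[s0 st] mB ->]]]]|[]//].
by rewrite -[X in measurable X]setTI; apply: mX => //; rewrite s0 (le_trans st).
Qed.

Lemma augmented_past_nondecreasing (s t : R) : (s <= t)%R ->
  <<s augmented_past P X s >> `<=` <<s augmented_past P X t >>.
Proof.
move=> st; apply: sub_smallest2r => // A [[i [u [B [/andP[u0 us] mB ->]]]]|];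
  last by right.
by left; exists i, u, B; split => //; rewrite u0 (le_trans us).
Qed.

End brownian_filtration.

Section state_price_density.
Context d {Omega : measurableType d} {R : realType}.
Variables (F : R -> set (set Omega)) (T : R).
Hypothesis Fnd : forall s t, (0 <= s)%R -> (s <= t)%R -> (t <= T)%R ->
  <<s F s >> `<=` <<s F t >>.

Lemma state_price_density_gt0 (xi0 : R) (r : R -> Omega -> R) n
    (theta : 'I_n -> R -> Omega -> R) (M : R -> Omega -> R) t w :
  (0 < xi0)%R -> (0 < state_price_density xi0 r theta M t w)%R.
Proof. by move=> xi0_gt0; rewrite mulr_gt0// expR_gt0. Qed.

Lemma progressive_state_price_density (xi0 : R) (r : R -> Omega -> R) n
    (theta : 'I_n -> R -> Omega -> R) (M : R -> Omega -> R) :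
  progressively_measurable F T r ->
  (forall i, progressively_measurable F T (theta i)) ->
  adapted F T M -> continuous_paths T M ->
  progressively_measurable F T (state_price_density xi0 r theta M).
Proof.
move=> pr pth aM cM t tT.
apply: measurable_funM => //; apply: measurableT_comp => //.
apply: measurable_funB.
  apply: measurable_funB.
    apply: measurableT_comp => //; exact: (progressive_Rintegral pr tT).
  exact: (continuous_adapted_progressive Fnd cM aM tT).
apply: measurable_funM => //.
apply: (progressive_Rintegral (T := T)
  (Y := fun s w => (\sum_(i < n) theta i s w ^+ 2)%R)) => //.
move=> s sT; apply: measurable_sum => i; apply: measurable_funX; exact: (pth i s sT).
Qed.

End state_price_density.

Theorem theorem1 (R : realType) (d : measure_display)
    (Omega : measurableType d) (P : probability Omega R)
    (T : R) (T_gt0 : (0 < T)%R) (n K : nat)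
    (X : 'I_n -> R -> Omega -> R) (X_brownian : brownian_motion P T X)
    (Pk : 'I_K -> probability Omega R) (Pk_dom : forall k, Pk k `<< P)
    (Z : 'I_K -> R -> Omega -> R)
    (Z_density : forall k,
       density_process P (augmented_past P X) T (Pk k) (Z k))
    (max_tau : P [set w | \big[maxe/-oo]_(k < K) first_zero T (Z k) w = +oo]
               = 1)
    (r : R -> Omega -> R)
    (r_prog : progressively_measurable (augmented_past P X) T r)
    (r_int : {ae P, forall w,
       \int[lebesgue_measure]_(s in `[0%R, T[) `|(r s w)%:E| < +oo})
    (theta : 'I_n -> R -> Omega -> R)
    (theta_prog : forall i,
       progressively_measurable (augmented_past P X) T (theta i))
    (theta_int : {ae P, forall w,
       \int[lebesgue_measure]_(s in `[0%R, T[)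
          (\sum_(i < n) theta i s w ^+ 2)%:E < +oo})
    (M : R -> Omega -> R)
    (M_ito : ito_integral P (augmented_past P X) T X theta M)
    (xi0 : R) (xi0_gt0 : (0 < xi0)%R)
    (c : R -> Omega -> R)
    (c_prog : progressively_measurable (augmented_past P X) T c)
    (c_ge0 : forall t w, (0 <= t <= T)%R -> (0 <= c t w)%R) :
  let xi := state_price_density xi0 r theta M in
  forall (k : 'I_K) (t : R) (V Vk W : Omega -> \bar R),
    (0 <= t <= T)%R ->
    fundamental_value P (augmented_past P X) T xi c t V ->
    fundamental_value (Pk k) (augmented_past P X) T
      (agent_state_price_density xi (Z k)) c t Vk ->
    cond_expectation P (augmented_past P X t)
      (fun w => \int[lebesgue_measure]_(s in
                  [set s | first_zero T (Z k) w <= s%:E < T%:E])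
                  (xi s w * c s w)%:E) W ->
    {ae P, forall w, t%:E < first_zero T (Z k) w ->
       V w = Vk w + ((xi t w)^-1)%:E * W w}.
Proof.
move=> xi k t V Vk W tT [W0 cW0 ->] [W1 cW1 ->] cW.
have T_ge0 := ltW T_gt0.
have [mX _ _ _] := X_brownian.
have FM s : (0 <= s <= T)%R -> <<s augmented_past P X s >> `<=` measurable.
  by move=> /andP[_ sT]; exact: augmented_past_measurable mX sT.
have Fnd s u : (0 <= s)%R -> (s <= u)%R -> (u <= T)%R ->
    <<s augmented_past P X s >> `<=` <<s augmented_past P X u >>.
  by move=> _ su _; exact: augmented_past_nondecreasing.
have [cZ dZ] := Z_density k.
have mZ s : (0 <= s <= T)%R ->
    measurable_fun [set: g_sigma_algebraType (augmented_past P X s)] (Z k s).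
  by move=> /dZ[+ _] => /measurable_EFinP.
have ZQ s : (0 <= s <= T)%R -> forall A, <<s augmented_past P X s >> A ->
    \int[P]_(w in A) (Z k s w)%:E = Pk k A.
  move=> sT A FA; have [_ ->//] := dZ s sT.
  by rewrite -Radon_Nikodym_integral//; [exact: Pk_dom|exact: FM FA].
have [aM cM _] := M_ito.
have pxi : progressively_measurable (augmented_past P X) T xi.
  exact: progressive_state_price_density.
have xi_gt0 s w : (0 < xi s w)%R by exact: state_price_density_gt0.
pose J : set (measurableTypeR R * Omega) := `[0%R, T] `*` setT.
have mJ : measurable J by apply: measurableX => //; exact: measurable_itv.
have JE s w : (0 <= s <= T)%R -> (s, w) \in J.
  by move=> sT; rewrite inE; split => //=; rewrite in_itv.
have jxi := progressive_joint FM T_ge0 pxi.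
have jc := progressive_joint FM T_ge0 c_prog.
have jZ := progressive_joint FM T_ge0 (continuous_adapted_progressive Fnd cZ mZ).
(* The processes are controlled only for times in [0, T]; extension by 0 provides the global
   measurability and sign that the decomposition asks for. *)
pose h := (fun p => xi p.1 p.2 * c p.1 p.2)%R \_ J.
pose iz := (fun p => (Z k p.1 p.2)^-1)%R \_ J.
have hE s w : (0 <= s <= T)%R -> h (s, w) = (xi s w * c s w)%R.
  by move=> sT; rewrite /h patchE JE.
have izE s w : (0 <= s <= T)%R -> iz (s, w) = ((Z k s w)^-1)%R.
  by move=> sT; rewrite /iz patchE JE.
have mh : measurable_fun setT h.
  by apply/(measurable_restrictT _ mJ); exact: measurable_funM.
have miz : measurable_fun setT iz.
  apply/(measurable_restrictT _ mJ).
  exact: (measurableT_comp (@measurable_invr R)).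
have h_ge0 p : (0 <= h p)%R.
  rewrite /h patchE; case: ifPn => //; rewrite inE => -[/= + _].
  by rewrite in_itv/= => pT; rewrite mulr_ge0 ?c_ge0// ltW.
have ah s : (0 <= s <= T)%R ->
    measurable_fun [set: g_sigma_algebraType (augmented_past P X s)]
      (fun w => h (s, w)).
  move=> sT; rewrite (_ : (fun w => _) = xi s \* c s)%R.
    apply: (@measurable_funM _ (g_sigma_algebraType (augmented_past P X s))).
      exact: progressive_adapted pxi _ sT.
    exact: progressive_adapted c_prog _ sT.
  by apply/funext => w; rewrite hE.
have := cond_expectation_decomposition T_ge0 FM Fnd (Pk_dom k) mZ ZQ cZ
  mh h_ge0 ah miz izE tT.
move=> /(_ W0 W1 W).
have tTs s : s \in `[t, T[%classic -> (0 <= s <= T)%R.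
  by rewrite inE/= in_itv/=; move: tT; lra.
have Y0E : (fun w => \int[lebesgue_measure]_(s in `[t, T[) (h (s, w))%:E) =
    (fun w => \int[lebesgue_measure]_(s in `[t, T[) (xi s w * c s w)%:E).
  by apply/funext => w; apply: eq_integral => s /tTs sT; rewrite hE.
have Y1E : (fun w => \int[lebesgue_measure]_(s in `[t, T[)
      (h (s, w) * iz (s, w))%:E) =
    (fun w => \int[lebesgue_measure]_(s in `[t, T[)
      (agent_state_price_density xi (Z k) s w * c s w)%:E).
  apply/funext => w; apply: eq_integral => s /tTs sT.
  by rewrite hE// izE// /agent_state_price_density mulrAC.
have YDE : (fun w => \int[lebesgue_measure]_(s in
      [set s | first_zero T (Z k) w <= s%:E < T%:E]) (h (s, w))%:E) =
    (fun w => \int[lebesgue_measure]_(s in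
      [set s | first_zero T (Z k) w <= s%:E < T%:E]) (xi s w * c s w)%:E).
  apply/funext => w; apply: eq_integral => s; rewrite inE/= lte_fin => /andP[ts sT].
  (* The infimum [first_zero] is at least 0, so the domain from it to [T] stays inside [0, T], where
     [h] is xi c. *)
  rewrite hE// (ltW sT) andbT -lee_fin; apply: le_trans ts.
  by apply: le_ereal_inf_tmp => _ [u [/andP[u0 _] _] <-]; rewrite lee_fin.
rewrite Y0E Y1E YDE => /(_ cW0 cW1 cW).
apply: filterS => w /[apply] -[Zw W1w Ww ->].
(* Both summands are nonnegative, so 1 / xi_t distributes; then Z_t / xi_t is the inverse of the
   agent's state price density. *)
rewrite ge0_muleDr//; last by rewrite mule_ge0// lee_fin ltW.
by rewrite muleA -EFinM /agent_state_price_density invf_div (mulrC (Z k t w)).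
Qed.
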